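(* A tangent line to the tropic curve of a non-degenerate quadric of the confocal family $(\mathcal{Q}_\lambda)$ in $\mathbf{E}^{2,1}$ is always space-like, except on a $1$-sheeted hyperboloid oriented along the $y$-axis. Tangent lines of a tropic curve on $1$-sheeted hyperboloids oriented along the $y$-axis are light-like exactly at four points, while at other points of the tropic curve the tangents are space-like. Moreover, a tangent line to the tropic curve of a quadric from the family belongs to the quadric if and only if it is light-like.
   Context: The three-dimensional Minkowski space $\mathbf{E}^{2,1}$ is $\mathbf{R}^3$ with coordinates $(x,y,z)$ and scalar product $\langle u,w\rangle=u_1w_1+u_2w_2-u_3w_3$. A line with direction vector $v\ne0$ is space-like, time-like or light-like if $\langle v,v\rangle$ is $>0$, $<0$ or $=0$. Fix constants $a>b>0$, $c>0$. The confocal family is $$\mathcal{Q}_\lambda:\ \frac{x^2}{a-\lambda}+\frac{y^2}{b-\lambda}+\frac{z^2}{c+\lambda}=1,\qquad\lambda\in\mathbf{R}.$$ It is non-degenerate for $\lambda\notin\{a,b,-c\}$. The $1$-sheeted hyperboloids oriented along the $y$-axis are the $\mathcal{Q}_\lambda$ with $\lambda\in(b,a)$; the other non-degenerate quadrics are $1$-sheeted hyperboloids oriented along the $z$-axis ($\lambda<-c$), ellipsoids ($-c<\lambda<b$), and $2$-sheeted hyperboloids ($\lambda>a$). The tropic curves on $\mathcal{Q}_\lambda$ are the set of its points where the metric induced by $\langle\cdot,\cdot\rangle$ on the tangent plane is degenerate (equivalently, the intersection of $\mathcal{Q}_\lambda$ with the cone $\frac{x^2}{(a-\lambda)^2}+\frac{y^2}{(b-\lambda)^2}-\frac{z^2}{(c+\lambda)^2}=0$);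 on each non-degenerate quadric there are two tropic curves, symmetric to each other with respect to the $xy$-plane, and the second paragraph refers to each one of them. *)

(* Defs.v *)
From mathcomp Require Import all_boot all_order all_algebra.
From mathcomp Require Import all_classical all_reals all_analysis.
Set Implicit Arguments.
Unset Strict Implicit.
Unset Printing Implicit Defensive.
Import Order.TTheory GRing.Theory Num.Theory.
Import numFieldNormedType.Exports.
Local Open Scope classical_set_scope.
Local Open Scope ring_scope.

Definition minkowski_prod (R : realType) (u w : 'rV[R]_3) : R :=
  u 0 0 * w 0 0 + u 0 1 * w 0 1 - u 0 2 * w 0 2.

Definition space_like (R : realType) (v : 'rV[R]_3) : Prop := 0 < minkowski_prod v v.

Definition light_like (R : realType) (v : 'rV[R]_3) : Prop := minkowski_prod v v = 0.

Definition line (R : realType) (p v : 'rV[R]_3) : set 'rV[R]_3 :=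
  [set p + t *: v | t in [set: R]].

(* Velocities at p of the parametrized curves that stay in S. *)
Definition tangent_vector (R : realType) (S : set 'rV[R]_3)
    (p v : 'rV[R]_3) : Prop :=
  exists g : R -> 'rV[R]_3,
    [/\ g 0 = p, \forall t \near (0 : R), S (g t) & is_derive (0 : R) 1 g v].

(* [line p v] is a tangent line to S at p. *)
Definition tangent_direction (R : realType) (S : set 'rV[R]_3)
    (p v : 'rV[R]_3) : Prop :=
  v != 0 /\ tangent_vector S p v.

Definition quadric (R : realType) (a b c lam : R) : set 'rV[R]_3 :=
  [set p : 'rV[R]_3 | p 0 0 ^+ 2 / (a - lam) + p 0 1 ^+ 2 / (b - lam)
           + p 0 2 ^+ 2 / (c + lam) = 1].

Definition nondegenerate_quadric (R : realType) (a b c lam : R) : Prop :=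
  [/\ lam != a, lam != b & lam != - c].

Definition oriented_along_y (R : realType) (a b lam : R) : Prop :=
  b < lam < a.

Definition degenerate_metric_at (R : realType) (S : set 'rV[R]_3)
    (p : 'rV[R]_3) : Prop :=
  exists v, [/\ v != 0, tangent_vector S p v &
    forall w, tangent_vector S p w -> minkowski_prod v w = 0].

Definition tropic_set (R : realType) (a b c lam : R) : set 'rV[R]_3 :=
  [set p | quadric a b c lam p /\ degenerate_metric_at (quadric a b c lam) p].

(* The two tropic curves of a quadric, one in z > 0 and one in z < 0, are the
   connected components of its tropic set. *)
Definition tropic_curve (R : realType) (a b c lam : R)
    (T : set 'rV[R]_3) : Prop :=
  exists2 p, tropic_set a b c lam p &
    T = connected_component (tropic_set a b c lam) p.

(* The existence clause keeps points without a tangent line out. *)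
Definition light_like_tangent_at (R : realType) (T : set 'rV[R]_3)
    (p : 'rV[R]_3) : Prop :=
  (exists v, tangent_direction T p v) /\
  forall v, tangent_direction T p v -> light_like v.

(* Main.v *)
Require Import Defs.
From mathcomp Require Import all_boot all_order all_algebra.
From mathcomp Require Import all_classical all_reals all_analysis.
From mathcomp Require Import ring lra.
Set Implicit Arguments.
Unset Strict Implicit.
Unset Printing Implicit Defensive.
Import Order.TTheory GRing.Theory Num.Theory.
Import numFieldNormedType.Exports.
Local Open Scope classical_set_scope.
Local Open Scope card_scope.
Local Open Scope ring_scope.

(* Put A = a - lam, B = b - lam, C = c + lam and write p = (Au, Bw, Cr).  The
   tropic set is u^2 + w^2 = r^2, (a+c) u^2 + (b+c) w^2 = 1: since a + c and
   b + c are positive, it consists, for every lam, of two graphs over one ellipse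
   of the (u, w)-plane, one in r > 0 and one in r < 0.  A velocity is determined
   by (u', w') = k (- (b+c) w, (a+c) u), and for
   D = A (b+c) w^2 + B (a+c) u^2 one finds
     r^2 <v, v> = (k D)^2   and   r^2 q(v) = k^2 D,
   where q is the quadratic form of the quadric.  Hence v is space-like unless
   D = 0, the tangent line lies in the quadric iff D = 0, and D vanishes on the
   ellipse only if A and B have opposite signs, then at four points. *)

(** * Coordinatewise differentiation of vectors in R^3 *)

Lemma is_derive_mx_coord (R : realFieldType) (V : normedModType R) m n
    (M : V -> 'M[R]_(m, n)) (x d : V) (M' : 'M[R]_(m, n)) :
  is_derive x d M M' <->
  forall i j, is_derive x d (fun t => M t i j) (M' i j).
Proof.
split=> [[dM <-] i j|dM].
  by split; [exact: ((derivable_mxP M x d).1 dM)|rewrite derive_mx// mxE].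
have dM0 : derivable M x d by apply/derivable_mxP => i j; exact: ex_derive.
split=> //; rewrite derive_mx//; apply/matrixP => i j.
by rewrite mxE; exact: derive_val.
Qed.

Definition row3 (R : Type) (x y z : R) : 'rV[R]_3 :=
  \row_(i < 3) nth x [:: x; y; z] i.

Lemma row3E (R : Type) (x y z : R) :
  (row3 x y z 0 0 = x) * (row3 x y z 0 1 = y) * (row3 x y z 0 2 = z).
Proof. by rewrite !mxE. Qed.

Lemma row3P (R : Type) (p q : 'rV[R]_3) :
  p 0 0 = q 0 0 -> p 0 1 = q 0 1 -> p 0 2 = q 0 2 -> p = q.
Proof.
move=> h0 h1 h2; apply/rowP => -[[|[|[|//]]] i3].
- by have -> : Ordinal i3 = 0 by exact: val_inj.
- by have -> : Ordinal i3 = 1 by exact: val_inj.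
- by have -> : Ordinal i3 = 2 by exact: val_inj.
Qed.

Lemma is_derive_row3 (R : realType) (f g h : R -> R) (x df dg dh : R) :
  is_derive x 1 f df -> is_derive x 1 g dg -> is_derive x 1 h dh ->
  is_derive x 1 (fun t => row3 (f t) (g t) (h t)) (row3 df dg dh).
Proof.
move=> Hf Hg Hh; apply/is_derive_mx_coord => i j; rewrite !mxE.
under eq_fun do rewrite mxE.
by case: j => -[|[|[|//]]] j3.
Qed.

(** * Diagonal quadratic forms and the tangent planes of their level sets *)

Definition diag_form (R : realType) (k1 k2 k3 : R) (u w : 'rV[R]_3) : R :=
  k1 * (u 0 0 * w 0 0) + k2 * (u 0 1 * w 0 1) + k3 * (u 0 2 * w 0 2).

(** Along a curve in S the form is constant near 0, while its derivative at 0 is twice the bilinear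
    form at (p, v). The level e is left free so that the quadric (e = 1) and the cone (e = 0) are
    both covered. *)
Lemma diag_form_tangent (R : realType) (k1 k2 k3 e : R) (S : set 'rV[R]_3)
    (p v : 'rV[R]_3) :
  (forall q, S q -> diag_form k1 k2 k3 q q = e) ->
  tangent_vector S p v -> diag_form k1 k2 k3 p v = 0.
Proof.
move=> Se [g [g0 Sg dg]].
have d i : is_derive (0 : R) 1 (fun t => g t 0 i) (v 0 i).
  by move/is_derive_mx_coord : dg => /(_ 0 i).
have dq : is_derive (0 : R) 1 (fun t => diag_form k1 k2 k3 (g t) (g t))
    (2 * diag_form k1 k2 k3 p v).
  rewrite /diag_form.
  apply: is_derive_eq; rewrite g0 /GRing.scale /=; ring.
have dc : is_derive (0 : R) 1 (fun t => diag_form k1 k2 k3 (g t) (g t)) 0.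
  apply: (@near_eq_is_derive _ _ _ (cst e)).
  by apply: filterS Sg => t /Se ->.
have := @derive_val _ _ _ _ _ _ _ dq; rewrite (@derive_val _ _ _ _ _ _ _ dc).
by move=> /esym/eqP; rewrite mulf_eq0 pnatr_eq0 => /eqP.
Qed.

(* Radial projection of the line p + tv back to the level set: by
   orthogonality the form takes the value 1 + t^2 q(v) on it. *)
Lemma tangent_diag_form_level (R : realType) (k1 k2 k3 : R)
    (p v : 'rV[R]_3) :
  diag_form k1 k2 k3 p p = 1 -> diag_form k1 k2 k3 p v = 0 ->
  tangent_vector [set q | diag_form k1 k2 k3 q q = 1] p v.
Proof.
move=> p1 pv.
pose m := diag_form k1 k2 k3 v v.
have n0 : \forall t \near (0 : R), 0 < 1 + t ^+ 2 * m.
  have : (fun t : R => 1 + t ^+ 2 * m) @ (0 : R) --> 1 + 0 ^+ 2 * m.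
    apply: cvgD; first exact: cvg_cst.
    by apply: cvgMl; exact: exprn_continuous.
  rewrite expr0n mul0r addr0 => /cvgr_gt; apply; exact: ltr01.
exists (fun t => (Num.sqrt (1 + t ^+ 2 * m))^-1 *: (p + t *: v)); split.
- by rewrite expr0n mul0r addr0 sqrtr1 invr1 scale1r scale0r addr0.
- apply: filterS n0 => t t0 /=.
  have s0 : Num.sqrt (1 + t ^+ 2 * m) != 0 by rewrite gt_eqF// sqrtr_gt0.
  have s2 := sqr_sqrtr (ltW t0).
  have -> : diag_form k1 k2 k3
      ((Num.sqrt (1 + t ^+ 2 * m))^-1 *: (p + t *: v))
      ((Num.sqrt (1 + t ^+ 2 * m))^-1 *: (p + t *: v))
    = (diag_form k1 k2 k3 p p + 2 * t * diag_form k1 k2 k3 p v + t ^+ 2 * m)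
      / Num.sqrt (1 + t ^+ 2 * m) ^+ 2.
    by rewrite /m /diag_form !mxE; field.
  by rewrite p1 pv mulr0 addr0 s2 divff// gt_eqF.
(* The factor 1 + t^2 m has zero derivative at t = 0, so rescaling does not change the velocity
   v. *)
- have dn : is_derive (0 : R) 1 (fun t : R => 1 + t ^+ 2 * m) 0.
    by apply: is_derive_eq; rewrite /GRing.scale /=; ring.
  have ds : is_derive (0 : R) 1 (fun t : R => (Num.sqrt (1 + t ^+ 2 * m))^-1) 0.
    have n1 : 1 + (0 : R) ^+ 2 * m = 1 by rewrite expr0n mul0r addr0.
    have dsq : is_derive (0 : R) 1 (fun t : R => Num.sqrt (1 + t ^+ 2 * m))
        ((2 * Num.sqrt (1 + (0 : R) ^+ 2 * m))^-1 * 0).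
      apply: (@is_derive1_comp _ Num.sqrt (fun t : R => 1 + t ^+ 2 * m)).
      by apply: is_derive1_sqrt; rewrite n1.
    have := @is_deriveV _ _ _ _ _ _ dsq.
    rewrite n1 sqrtr1 oner_eq0 mulr0 scaler0; exact.
  apply/is_derive_mx_coord => i j; under eq_fun do rewrite !mxE.
  apply: is_derive_eq.
  by rewrite expr0n mul0r addr0 sqrtr1 /GRing.scale /=; field.
Qed.

Lemma quadricE (R : realType) (a b c lam : R) :
  quadric a b c lam =
  [set p | diag_form (a - lam)^-1 (b - lam)^-1 (c + lam)^-1 p p = 1].
Proof.
apply/funext => p; rewrite /quadric /diag_form /=.
by congr (_ = 1); ring.
Qed.

(** Identifies the tangent plane with the orthogonal complement of p: velocities are orthogonal to
    p, and radial projection realizes every vector orthogonal to p. *)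
Lemma quadric_tangentP (R : realType) (a b c lam : R) (p v : 'rV[R]_3) :
  quadric a b c lam p ->
  tangent_vector (quadric a b c lam) p v <->
  diag_form (a - lam)^-1 (b - lam)^-1 (c + lam)^-1 p v = 0.
Proof.
rewrite quadricE => /= p1; split=> [|pv].
  exact: (@diag_form_tangent _ _ _ _ 1).
exact: tangent_diag_form_level.
Qed.

(** * The tropic set as the intersection of the quadric with a cone *)

Lemma nondegenerate_quadric_neq0 (R : realType) (a b c lam : R) :
  nondegenerate_quadric a b c lam ->
  [/\ a - lam != 0, b - lam != 0 & c + lam != 0].
Proof.
by move=> [la lb lc]; rewrite !subr_eq0 addrC addr_eq0 !(eq_sym _ lam).
Qed.

(* With n the covector of the tangent plane, the plane is degenerate iff its
   Minkowski normal is tangent; [v] is proportional to that normal because it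
   is Minkowski-orthogonal to the vectors n x e_i. *)
Lemma tropic_setP (R : realType) (a b c lam : R) (p : 'rV[R]_3) :
  nondegenerate_quadric a b c lam ->
  tropic_set a b c lam p <->
  quadric a b c lam p /\
  diag_form ((a - lam) ^- 2) ((b - lam) ^- 2) (- (c + lam) ^- 2) p p = 0.
Proof.
move=> nd; have [A0 B0 C0] := nondegenerate_quadric_neq0 nd.
split=> -[pQ].
  move=> [v [v0 /(quadric_tangentP _ pQ) pv vw]]; split=> //.
  move: pv; rewrite {1}/diag_form; set A := a - lam; set B := b - lam; set C := c + lam.
  move=> pv.
  have orth x y z : A^-1 * (p 0 0 * x) + B^-1 * (p 0 1 * y) +
      C^-1 * (p 0 2 * z) = 0 -> v 0 0 * x + v 0 1 * y - v 0 2 * z = 0.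
    move=> h; have := vw (row3 x y z); rewrite /minkowski_prod !row3E; apply.
    by apply/(quadric_tangentP _ pQ); rewrite /diag_form !row3E.
  have e1 : v 0 1 * (C^-1 * p 0 2) + v 0 2 * (B^-1 * p 0 1) = 0.
    rewrite -(orth 0 (C^-1 * p 0 2) (- (B^-1 * p 0 1))); ring.
  have e2 : v 0 0 * (C^-1 * p 0 2) + v 0 2 * (A^-1 * p 0 0) = 0.
    rewrite -(orth (C^-1 * p 0 2) 0 (- (A^-1 * p 0 0))); ring.
  have e3 : v 0 0 * (B^-1 * p 0 1) - v 0 1 * (A^-1 * p 0 0) = 0.
    rewrite -(orth (B^-1 * p 0 1) (- (A^-1 * p 0 0)) 0); ring.
  rewrite /diag_form -/A -/B -/C.
  set N := (X in X = 0).
  have NE : N = (A^-1 * p 0 0) ^+ 2 + (B^-1 * p 0 1) ^+ 2 - (C^-1 * p 0 2) ^+ 2.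
    by rewrite /N; field; rewrite A0 B0 C0.
  (* If N were nonzero, v would vanish: with n = (p 0 0 / A, p 0 1 / B, p 0 2 / C), each N v_i is a
     combination of the null expressions in [pv], [e1], [e2], [e3] with coefficients the coordinates
     of n, up to sign. *)
  apply: contra_notP (elimN eqP v0) => /eqP N0.
  apply: row3P; rewrite mxE; apply: (mulfI N0); rewrite mulr0 NE.
  - rewrite -[RHS](_ : A^-1 * p 0 0 * 0 + B^-1 * p 0 1 * 0
      - C^-1 * p 0 2 * 0 = 0); last by ring.
    by rewrite -{1}pv -{1}e3 -e2; ring.
  - rewrite -[RHS](_ : B^-1 * p 0 1 * 0 - A^-1 * p 0 0 * 0
      - C^-1 * p 0 2 * 0 = 0); last by ring.
    by rewrite -{1}pv -{1}e3 -e1; ring.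
  - rewrite -[RHS](_ : A^-1 * p 0 0 * 0 + B^-1 * p 0 1 * 0
      - C^-1 * p 0 2 * 0 = 0); last by ring.
    by rewrite -{1}e2 -{1}e1 -pv; ring.
move=> cone; split=> //.
have p1 := pQ; rewrite quadricE /= /diag_form in p1.
move: cone; rewrite /diag_form.
set A := a - lam; set B := b - lam; set C := c + lam => cone.
(* The Minkowski normal: the covector with its last sign changed. The cone equation says precisely
   that it is tangent. *)
exists (row3 (p 0 0 / A) (p 0 1 / B) (- (p 0 2 / C))); split.
- apply/eqP => /rowP h.
  have h0 := h 0; have h1 := h 1; have h2 := h 2%:R; rewrite !mxE /= in h0 h1 h2.
  move: p1; rewrite -/A -/B -/C => p1.
  suff : (1 : R) = 0 by move/eqP; rewrite oner_eq0.
  rewrite -p1.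
  have -> : p 0 0 = 0 by rewrite -[p 0 0](divfK A0) h0 mul0r.
  have -> : p 0 1 = 0 by rewrite -[p 0 1](divfK B0) h1 mul0r.
  have -> : p 0 2 = 0 by rewrite -[p 0 2](divfK C0) -[_ / _]opprK h2 oppr0 mul0r.
  by ring.
- apply/(quadric_tangentP _ pQ); rewrite /diag_form !row3E -/A -/B -/C -cone.
  by field; rewrite A0 B0 C0.
- move=> w /(quadric_tangentP _ pQ) pw; rewrite /minkowski_prod !row3E.
  rewrite -pw /diag_form -/A -/B -/C; ring.
Qed.

(** * Velocities on the tropic set in the coordinates u, w, r *)

(** Eliminating r r' between the two tangency conditions leaves tangency to the ellipse, so (u', w')
    is the multiple k of (- (B + C) w, (A + C) u), the ellipse equation providing the normalization.
    Then r r' is also known, and the factor r^2 in the conclusions avoids dividing by r. *)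
Lemma tropic_velocity (F : comPzRingType) (A B C u w r u' w' r' : F) :
  u ^+ 2 + w ^+ 2 = r ^+ 2 -> (A + C) * u ^+ 2 + (B + C) * w ^+ 2 = 1 ->
  A * (u * u') + B * (w * w') + C * (r * r') = 0 ->
  u * u' + w * w' - r * r' = 0 ->
  let k := u * w' - w * u' in
  let D := A * (B + C) * w ^+ 2 + B * (A + C) * u ^+ 2 in
  [/\ u' = - (k * (B + C) * w), w' = k * (A + C) * u,
      r ^+ 2 * (A ^+ 2 * u' ^+ 2 + B ^+ 2 * w' ^+ 2 - C ^+ 2 * r' ^+ 2)
        = (k * D) ^+ 2 &
      r ^+ 2 * (A * u' ^+ 2 + B * w' ^+ 2 + C * r' ^+ 2) = k ^+ 2 * D].
Proof.
move=> cone ellipse tq tc k D.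
have te : (A + C) * (u * u') + (B + C) * (w * w') = 0.
  have -> : (A + C) * (u * u') + (B + C) * (w * w') =
    A * (u * u') + B * (w * w') + C * (r * r')
    + C * (u * u' + w * w' - r * r') by ring.
  by rewrite tq tc mulr0 addr0.
have eu : u' = - (k * (B + C) * w).
  apply/eqP; rewrite -subr_eq0 -[u']mul1r -ellipse; apply/eqP.
  transitivity (u * ((A + C) * (u * u') + (B + C) * (w * w'))).
    by rewrite /k; ring.
  by rewrite te mulr0.
have ew : w' = k * (A + C) * u.
  apply/eqP; rewrite -subr_eq0 -[w']mul1r -ellipse; apply/eqP.
  transitivity (w * ((A + C) * (u * u') + (B + C) * (w * w'))).
    by rewrite /k; ring.
  by rewrite te mulr0.
have er : r * r' = k * (A - B) * u * w.
  transitivity (u * u' + w * w'); last by rewrite {1}eu {1}ew; ring.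
  by apply/esym/eqP; rewrite -subr_eq0 tc.
clearbody k; split=> //.
- transitivity (r ^+ 2 * (A ^+ 2 * u' ^+ 2 + B ^+ 2 * w' ^+ 2)
    - C ^+ 2 * (r * r') ^+ 2); first by ring.
  by rewrite er -cone eu ew /D; ring.
- transitivity (r ^+ 2 * (A * u' ^+ 2 + B * w' ^+ 2)
    + C * (r * r') ^+ 2); first by ring.
  (* In u and w the left side has degree 4 but D only degree 2; the ellipse equation, inserted for
     1, restores homogeneity. *)
  rewrite er -cone eu ew -[RHS]mulr1 -ellipse /D; ring.
Qed.

(** With u = x / A, w = y / B, r = z / C the quadric is A u^2 + B w^2 + C r^2 = 1 and the cone is
    u^2 + w^2 = r^2. Substituting for r^2 gives the ellipse, and lam cancels in A + C = a + c and B
    + C = b + c. *)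
Lemma tropic_setE (R : realType) (a b c lam : R) (p : 'rV[R]_3) :
  nondegenerate_quadric a b c lam ->
  tropic_set a b c lam p <->
  (p 0 0 / (a - lam)) ^+ 2 + (p 0 1 / (b - lam)) ^+ 2
    = (p 0 2 / (c + lam)) ^+ 2 /\
  (a + c) * (p 0 0 / (a - lam)) ^+ 2 + (b + c) * (p 0 1 / (b - lam)) ^+ 2 = 1.
Proof.
move=> nd; have [A0 B0 C0] := nondegenerate_quadric_neq0 nd.
rewrite (tropic_setP _ nd) quadricE /= /diag_form.
rewrite (_ : a + c = (a - lam) + (c + lam)); last by ring.
rewrite (_ : b + c = (b - lam) + (c + lam)); last by ring.
set A := a - lam in A0 *; set B := b - lam in B0 *; set C := c + lam in C0 *.
set u := _ / A; set w := _ / B; set r := _ / C.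
have eu : p 0 0 = A * u by rewrite /u; field.
have ew : p 0 1 = B * w by rewrite /w; field.
have er : p 0 2 = C * r by rewrite /r; field.
rewrite eu ew er.
rewrite (_ : A^-1 * _ + _ + _ = A * u ^+ 2 + B * w ^+ 2 + C * r ^+ 2); last first.
  by field; rewrite A0 B0 C0.
rewrite (_ : A ^- 2 * _ + _ + _ = u ^+ 2 + w ^+ 2 - r ^+ 2); last first.
  by field; rewrite A0 B0 C0.
clearbody u w r; split=> -[e1 e2].
  have e3 : u ^+ 2 + w ^+ 2 = r ^+ 2 by apply/eqP; rewrite -subr_eq0 e2.
  by split=> //; rewrite -e1 -e3; ring.
by rewrite -e1 subrr -e2; split=> //; ring.
Qed.

(** r = 0 would force u = w = 0, against the ellipse equation. Hence r can be cancelled, and its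
    sign separates the two halves. *)
Lemma tropic_height_neq0 (R : realType) (a b c lam : R) (p : 'rV[R]_3) :
  nondegenerate_quadric a b c lam -> tropic_set a b c lam p ->
  p 0 2 / (c + lam) != 0.
Proof.
move=> nd /(tropic_setE _ nd)[cone ellipse].
apply/eqP => r0; move: cone; rewrite r0 expr0n /= => /eqP.
rewrite paddr_eq0 ?sqr_ge0// => /andP[/eqP u0 /eqP w0].
by move/eqP: ellipse; rewrite u0 w0 !mulr0 addr0 eq_sym oner_eq0.
Qed.

(* For p = (Au, Bw, Cr), with A, B, C the denominators of the quadric, this is
   the quantity D of [tropic_velocity]. *)
Definition tropic_discr (R : realType) (a b c lam : R) (p : 'rV[R]_3) : R :=
  (a - lam) * (b + c) * (p 0 1 / (b - lam)) ^+ 2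
  + (b - lam) * (a + c) * (p 0 0 / (a - lam)) ^+ 2.

(** A velocity of the tropic set is tangent both to the quadric and to the cone, so
    [tropic_velocity] applies to it; k is nonzero because v is. *)
Lemma tropic_tangent (R : realType) (a b c lam : R) (p v : 'rV[R]_3) :
  nondegenerate_quadric a b c lam -> tropic_set a b c lam p ->
  tangent_direction (tropic_set a b c lam) p v ->
  exists k, [/\ 0 < k ^+ 2, 0 < (p 0 2 / (c + lam)) ^+ 2,
    (p 0 2 / (c + lam)) ^+ 2 * minkowski_prod v v
      = (k * tropic_discr a b c lam p) ^+ 2 &
    (p 0 2 / (c + lam)) ^+ 2
      * diag_form (a - lam)^-1 (b - lam)^-1 (c + lam)^-1 v v
      = k ^+ 2 * tropic_discr a b c lam p].
Proof.
move=> nd pT [v0 tv]; have [A0 B0 C0] := nondegenerate_quadric_neq0 nd.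
have tq : diag_form (a - lam)^-1 (b - lam)^-1 (c + lam)^-1 p v = 0.
  apply: (diag_form_tangent (e := 1)) tv => q [].
  by rewrite quadricE.
have tc : diag_form ((a - lam) ^- 2) ((b - lam) ^- 2) (- (c + lam) ^- 2) p v = 0.
  by apply: (diag_form_tangent (e := 0)) tv => q /(tropic_setP _ nd)[].
have r0 := tropic_height_neq0 nd pT.
move: pT => /(tropic_setE _ nd); rewrite /tropic_discr.
rewrite (_ : a + c = (a - lam) + (c + lam)); last by ring.
rewrite (_ : b + c = (b - lam) + (c + lam)); last by ring.
move: tq tc; rewrite /minkowski_prod /diag_form.
set A := a - lam in A0 *; set B := b - lam in B0 *; set C := c + lam in C0 r0 *.
move=> tq tc [cone ellipse].
have [||eu ew H1 H2] := @tropic_velocity _ A B C (p 0 0 / A) (p 0 1 / B)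
    (p 0 2 / C) (v 0 0 / A) (v 0 1 / B) (v 0 2 / C) cone ellipse.
- by rewrite -tq; field; rewrite A0 B0 C0.
- by rewrite -tc; field; rewrite A0 B0 C0.
move: eu ew H1 H2; set k := _ - _ => eu ew H1 H2.
exists k; split.
- rewrite exprn_even_gt0//=; apply: contraNneq v0 => k0.
  have u0 : v 0 0 = 0.
    by rewrite -[v 0 0](divfK A0) eu k0; ring.
  have w0 : v 0 1 = 0.
    by rewrite -[v 0 1](divfK B0) ew k0; ring.
  (* Once the first two coordinates of v vanish, tangency to the cone leaves only the product of the
     heights of p and v, and r is nonzero. *)
  apply/eqP/row3P; rewrite mxE//; apply: (mulfI r0).
  move: tc; rewrite u0 w0 !mulr0 !add0r => /eqP.
  rewrite mulNr oppr_eq0 mulf_eq0 invr_eq0 expf_eq0 (negPf C0) andbF /=.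
  by rewrite mulf_eq0 => /orP[]/eqP ->; rewrite ?mul0r ?mulr0.
- by rewrite exprn_even_gt0.
- by rewrite -H1; congr (_ * _); field; rewrite A0 B0 C0.
- by rewrite -H2; congr (_ * _); field; rewrite A0 B0 C0.
Qed.

(** * The two halves of the tropic set: parametrization and connectedness *)

(** The graph r = e sqrt(u^2 + w^2), scaled back to (Au, Bw, Cr); e is meant as a sign. *)
Definition tropic_point (R : realType) (a b c lam e u w : R) : 'rV[R]_3 :=
  row3 ((a - lam) * u) ((b - lam) * w)
    ((c + lam) * (e * Num.sqrt (u ^+ 2 + w ^+ 2))).

(** The sign compared with e is that of r = z / C, which differs from the sign of z when c + lam <
    0. *)
Definition tropic_half (R : realType) (a b c lam e : R) : set 'rV[R]_3 :=
  [set p | tropic_set a b c lam p /\ 0 < e * (p 0 2 / (c + lam))].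

Lemma tropic_halfP (R : realType) (a b c lam e : R) (p : 'rV[R]_3) :
  nondegenerate_quadric a b c lam -> e * e = 1 ->
  tropic_half a b c lam e p <->
  exists u w, (a + c) * u ^+ 2 + (b + c) * w ^+ 2 = 1 /\
    p = tropic_point a b c lam e u w.
Proof.
move=> nd ee; have [A0 B0 C0] := nondegenerate_quadric_neq0 nd.
rewrite /tropic_half /= (tropic_setE _ nd); split.
  move=> [[cone ellipse] er0].
  exists (p 0 0 / (a - lam)), (p 0 1 / (b - lam)); split=> //.
  apply: row3P; rewrite !row3E; [by field|by field|].
  rewrite cone -[X in Num.sqrt X]mul1r -ee -expr2 -exprMn sqrtr_sqr gtr0_norm//.
  by rewrite [e * _]mulrA ee mul1r mulrC divfK.
move=> [u [w [ellipse ->]]]; rewrite !row3E.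
rewrite ![_ * u / _]mulrAC ![_ * w / _]mulrAC ![_ * (e * _) / _]mulrAC.
rewrite !divff// !mul1r mulrA ee mul1r exprMn [e ^+ 2]ee mul1r.
rewrite sqr_sqrtr ?addr_ge0 ?sqr_ge0//; split=> //.
rewrite sqrtr_gt0 lt_neqAle eq_sym addr_ge0 ?sqr_ge0// andbT.
rewrite paddr_eq0 ?sqr_ge0//; apply/negP => /andP[/eqP u0 /eqP w0].
by move/eqP: ellipse; rewrite u0 w0 !mulr0 addr0 eq_sym oner_eq0.
Qed.

(** The angle acos x has cosine x and sine |y|; it is negated when y < 0. *)
Lemma cos_sin_onto (R : realType) (x y : R) :
  x ^+ 2 + y ^+ 2 = 1 -> exists t, x = cos t /\ y = sin t.
Proof.
move=> xy1.
have x1 : -1 <= x <= 1.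
  by rewrite -ler_norml -(expr_le1 (n := 2))// real_normK ?num_real//
    -xy1 lerDl sqr_ge0.
have sy : sin (acos x) = `|y|.
  by rewrite sin_acos// -xy1 addrAC subrr add0r sqrtr_sqr.
have cx : cos (acos x) = x by rewrite acosK// in_itv.
have [y0|y0] := leP 0 y.
  by exists (acos x); rewrite cx sy ger0_norm.
by exists (- acos x); rewrite cosN sinN cx sy ltr0_norm// opprK.
Qed.

Definition tropic_param (R : realType) (a b c lam e t : R) : 'rV[R]_3 :=
  tropic_point a b c lam e (cos t / Num.sqrt (a + c)) (sin t / Num.sqrt (b + c)).

(** Presents a half as the image of the real line under the angle on the ellipse, which yields both
    its connectedness and its tangent vectors. *)
Lemma tropic_half_range (R : realType) (a b c lam e : R) :
  0 < a + c -> 0 < b + c -> nondegenerate_quadric a b c lam -> e * e = 1 ->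
  tropic_half a b c lam e = range (tropic_param a b c lam e).
Proof.
move=> ac bc nd ee.
have sa : Num.sqrt (a + c) != 0 by rewrite gt_eqF// sqrtr_gt0.
have sb : Num.sqrt (b + c) != 0 by rewrite gt_eqF// sqrtr_gt0.
have sa2 := sqr_sqrtr (ltW ac); have sb2 := sqr_sqrtr (ltW bc).
apply/seteqP; split=> p.
  move/(tropic_halfP _ nd ee) => [u [w [ellipse ->]]].
  have [|t [ct st]] := @cos_sin_onto _ (Num.sqrt (a + c) * u) (Num.sqrt (b + c) * w).
    by rewrite !exprMn sa2 sb2.
  exists t => //; rewrite /tropic_param -ct -st.
  by congr tropic_point; field.
move=> [t _ <-]; apply/(tropic_halfP _ nd ee); do 2 eexists; split; last by [].
rewrite !exprMn !exprVn sa2 sb2 -(cos2Dsin2 t); field.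
by rewrite !gt_eqF.
Qed.

(** The radicand is positive since cosine and sine have no common zero, so the square root is
    differentiable. The third component stays unspecified: the first two already show that the
    velocity is nonzero. *)
Lemma is_derive_tropic_param (R : realType) (a b c lam e t : R) :
  0 < a + c -> 0 < b + c ->
  exists d, is_derive t 1 (tropic_param a b c lam e)
    (row3 (- ((a - lam) * (sin t / Num.sqrt (a + c))))
          ((b - lam) * (cos t / Num.sqrt (b + c))) d).
Proof.
move=> ac bc.
have sa : Num.sqrt (a + c) != 0 by rewrite gt_eqF// sqrtr_gt0.
have sb : Num.sqrt (b + c) != 0 by rewrite gt_eqF// sqrtr_gt0.
pose N x := (cos x / Num.sqrt (a + c)) ^+ 2 + (sin x / Num.sqrt (b + c)) ^+ 2.
have N0 : 0 < N t.
  rewrite /N lt_neqAle eq_sym addr_ge0 ?sqr_ge0// andbT.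
  rewrite paddr_eq0 ?sqr_ge0// !expf_eq0 /= !mulf_eq0 !invr_eq0.
  rewrite (negPf sa) (negPf sb) !orbF; apply/negP => /andP[/eqP ct /eqP st].
  by have /eqP := cos2Dsin2 t; rewrite ct st expr0n addr0 eq_sym oner_eq0.
have [dN HN] : exists dN, is_derive t 1 N dN.
  by eexists; rewrite /N; apply: is_derive_eq.
have HS : is_derive t 1 (fun x => Num.sqrt (N x)) ((2 * Num.sqrt (N t))^-1 * dN).
  by apply: (@is_derive1_comp _ Num.sqrt N); exact: is_derive1_sqrt.
exists ((c + lam) * (e * ((2 * Num.sqrt (N t))^-1 * dN))).
apply: is_derive_row3; apply: is_derive_eq; rewrite /GRing.scale /=; ring.
Qed.

Lemma connected_tropic_half (R : realType) (a b c lam e : R) :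
  0 < a + c -> 0 < b + c -> nondegenerate_quadric a b c lam -> e * e = 1 ->
  connected (tropic_half a b c lam e).
Proof.
move=> ac bc nd ee; rewrite (tropic_half_range ac bc nd ee).
apply: connected_continuous_connected.
  by apply/connected_intervalP.
apply: continuous_subspaceT => t.
have [d [dt _]] := is_derive_tropic_param lam e t ac bc.
exact/differentiable_continuous/derivable1_diffP.
Qed.

(** The continuous function e z / C has no zero on the tropic set, so on a connected component it
    keeps the sign it has at p. Conversely the half containing p is connected, hence lies in the
    component. *)
Lemma tropic_curve_half (R : realType) (a b c lam : R) (T : set 'rV[R]_3) :
  0 < a + c -> 0 < b + c -> nondegenerate_quadric a b c lam ->
  tropic_curve a b c lam T ->
  exists2 e, e * e = 1 & T = tropic_half a b c lam e.
Proof.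
move=> ac bc nd [p pT ->].
have r0 q := @tropic_height_neq0 _ a b c lam q nd.
pose e := Num.sg (p 0 2 / (c + lam)).
have ee : e * e = 1 by rewrite -expr2 sqr_sg r0.
have ep : tropic_half a b c lam e p.
  by split=> //; rewrite -normrEsg normr_gt0 r0.
exists e => //; apply/seteqP; split=> [q qT|].
  have qS := connected_component_sub qT.
  split=> //; rewrite ltNge; apply/negP => eq0.
  pose f (x : 'rV[R]_3) := e * (x 0 2 / (c + lam)).
  have : connected (f @` connected_component (tropic_set a b c lam) p).
    apply: connected_continuous_connected; first exact: component_connected.
    apply: continuous_subspaceT => x.
    apply: (@continuous_comp _ _ _ (fun q : 'rV[R]_3 => q 0 2)
      (fun r : R => e * (r / (c + lam)))); first exact: coord_continuous.
    by apply: cvgM; [exact: cvg_cst|apply: cvgMl; exact: cvg_id].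
  move/connected_intervalP/(_ (f q) (f p)) => /(_ _ _ 0)[].
  - by exists q.
  - by exists p => //; exact: connected_component_refl.
  - by rewrite eq0 ltW// ep.2.
  - move=> x /connected_component_sub/r0 /negP xn /eqP.
    rewrite /f mulf_eq0 => /orP[/eqP e0|//].
    by move/eqP: ee; rewrite e0 mulr0 eq_sym oner_eq0.
apply: connected_component_max => //; first by move=> x [].
exact: connected_tropic_half.
Qed.

(** * Existence of tangents on a half, and the zeros of the discriminant *)

(** The velocity of the parametrization, shifted to time 0, supplies the existence clause of
    [light_like_tangent_at]. *)
Lemma tropic_half_tangent_direction (R : realType) (a b c lam e : R)
    (p : 'rV[R]_3) :
  0 < a + c -> 0 < b + c -> nondegenerate_quadric a b c lam -> e * e = 1 ->
  tropic_half a b c lam e p ->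
  exists v, tangent_direction (tropic_half a b c lam e) p v.
Proof.
move=> ac bc nd ee; rewrite (tropic_half_range ac bc nd ee) => -[t0 _ <-].
have [A0 B0 C0] := nondegenerate_quadric_neq0 nd.
have sa : Num.sqrt (a + c) != 0 by rewrite gt_eqF// sqrtr_gt0.
have sb : Num.sqrt (b + c) != 0 by rewrite gt_eqF// sqrtr_gt0.
have [d Hd] := is_derive_tropic_param lam e t0 ac bc.
exists (row3 (- ((a - lam) * (sin t0 / Num.sqrt (a + c))))
             ((b - lam) * (cos t0 / Num.sqrt (b + c))) d); split; last first.
  exists (fun t => tropic_param a b c lam e (t + t0)); split.
  - by rewrite add0r.
  - by apply: filterE => t; exists (t + t0).
  - apply/is_derive_mx_coord => i j.
    have /is_derive_mx_coord/(_ i j) Hij := Hd.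
    have Hs : is_derive (0 : R) 1 (fun t : R => t + t0) 1.
      by apply: is_derive_eq; rewrite addr0.
    rewrite -[t0 in is_derive t0]add0r in Hij.
    have := @is_derive1_comp _ (fun t => tropic_param a b c lam e t i j)
      (fun t : R => t + t0) 0 _ _ Hij Hs.
    by rewrite mulr1; exact.
apply/eqP => /rowP h.
have h0 := h 0; have h1 := h 1; rewrite !mxE /= in h0 h1.
have /eqP := cos2Dsin2 t0.
move/eqP: h0; rewrite oppr_eq0 !mulf_eq0 (negPf A0) invr_eq0 (negPf sa) orbF /=.
move=> /eqP ->.
move/eqP: h1; rewrite !mulf_eq0 (negPf B0) invr_eq0 (negPf sb) orbF /=.
move=> /eqP ->.
by rewrite expr0n addr0 eq_sym oner_eq0.
Qed.

(* The discriminant and the equation of the ellipse determine u^2 and w^2. *)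
Lemma card_tropic_discr0 (R : realType) (a b c lam e : R) :
  0 < a + c -> 0 < b + c -> b < lam -> lam < a ->
  nondegenerate_quadric a b c lam -> e * e = 1 ->
  [set p | tropic_half a b c lam e p /\ tropic_discr a b c lam p = 0] #= `I_4.
Proof.
move=> ac bc lb la nd ee.
have [A0 B0 C0] := nondegenerate_quadric_neq0 nd.
have ab0 : 0 < a - b by lra.
have [ac0 bc0 ab0'] : [/\ a + c != 0, b + c != 0 & a - b != 0].
  by rewrite !gt_eqF.
(* The squares of [u0] and [w0] solve the linear system formed by the ellipse and D = 0; both are
   positive because b < lam < a. *)
pose u0 := Num.sqrt ((a - lam) / ((a + c) * (a - b))).
pose w0 := Num.sqrt ((lam - b) / ((b + c) * (a - b))).
have u0_gt0 : 0 < u0 by rewrite sqrtr_gt0 divr_gt0 ?mulr_gt0// subr_gt0.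
have w0_gt0 : 0 < w0 by rewrite sqrtr_gt0 divr_gt0 ?mulr_gt0// subr_gt0.
have u02 : u0 ^+ 2 = (a - lam) / ((a + c) * (a - b)).
  by rewrite sqr_sqrtr// ltW// -sqrtr_gt0.
have w02 : w0 ^+ 2 = (lam - b) / ((b + c) * (a - b)).
  by rewrite sqr_sqrtr// ltW// -sqrtr_gt0.
(* The two binary digits of n < 4 encode the signs of u and w. *)
pose f (n : nat) := tropic_point a b c lam e
  ((-1) ^+ odd n * u0) ((-1) ^+ odd n./2 * w0).
suff -> : [set p | tropic_half a b c lam e p /\ tropic_discr a b c lam p = 0]
    = f @` `I_4.
  apply: inj_card_eq => m n; rewrite !inE /= => m4 n4 fmn.
  have h0 : (-1) ^+ odd m * u0 = (-1) ^+ odd n * u0.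
    apply: (mulfI A0).
    by have := congr1 (fun q : 'rV[R]_3 => q 0 0) fmn; rewrite !row3E.
  have h1 : (-1) ^+ odd m./2 * w0 = (-1) ^+ odd n./2 * w0.
    apply: (mulfI B0).
    by have := congr1 (fun q : 'rV[R]_3 => q 0 1) fmn; rewrite !row3E.
  have /(mulIf (lt0r_neq0 u0_gt0))/eqP := h0.
  have /(mulIf (lt0r_neq0 w0_gt0))/eqP := h1.
  rewrite !(inj_eq signr_inj).
  by move: m n m4 n4 {fmn h0 h1} => [|[|[|[|//]]]] [|[|[|[|//]]]].
have dE u w : tropic_discr a b c lam (tropic_point a b c lam e u w) =
    (a - lam) * (b + c) * w ^+ 2 + (b - lam) * (a + c) * u ^+ 2.
  by rewrite /tropic_discr !row3E; field; rewrite A0 B0.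
apply/seteqP; split=> p /=.
  move=> [/(tropic_halfP _ nd ee) [u [w [ellipse ->]]]]; rewrite dE => d0.
  have u2 : u ^+ 2 = u0 ^+ 2.
    apply: (mulfI ac0); apply: (mulfI ab0'); rewrite u02.
    transitivity ((a - lam) * ((a + c) * u ^+ 2 + (b + c) * w ^+ 2)
     - ((a - lam) * (b + c) * w ^+ 2 + (b - lam) * (a + c) * u ^+ 2)).
      by ring.
    by rewrite d0 ellipse; field; rewrite ac0 ab0'.
  have w2 : w ^+ 2 = w0 ^+ 2.
    apply: (mulfI bc0); apply: (mulfI ab0'); rewrite w02.
    transitivity ((lam - b) * ((a + c) * u ^+ 2 + (b + c) * w ^+ 2)
     + ((a - lam) * (b + c) * w ^+ 2 + (b - lam) * (a + c) * u ^+ 2)).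
      by ring.
    by rewrite d0 ellipse; field; rewrite bc0 ab0'.
  move/eqP: u2; rewrite eqf_sqr => /orP[]/eqP ->;
  move/eqP: w2; rewrite eqf_sqr => /orP[]/eqP ->.
  - by exists 0%N => //; rewrite /f /= !mul1r.
  - by exists 2%N => //; rewrite /f /= mul1r mulN1r.
  - by exists 1%N => //; rewrite /f /= mul1r mulN1r.
  - by exists 3%N => //; rewrite /f /= !mulN1r.
move=> [n _ <-]; split.
  apply/(tropic_halfP _ nd ee); do 2 eexists; split; last by [].
  rewrite !exprMn !sqrr_sign u02 w02; field.
  by rewrite ac0 bc0 ab0'.
by rewrite dE !exprMn !sqrr_sign u02 w02; field; rewrite ac0 bc0 ab0'.
Qed.

(** * Causal type of the tangents, and lines contained in the quadric *)

(** In r^2 <v, v> = (k D)^2 both r and k are nonzero. *)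
Lemma light_like_tropicP (R : realType) (a b c lam : R) (p v : 'rV[R]_3) :
  nondegenerate_quadric a b c lam -> tropic_set a b c lam p ->
  tangent_direction (tropic_set a b c lam) p v ->
  light_like v <-> tropic_discr a b c lam p = 0.
Proof.
move=> nd pS tv; have [k [k0 r0 Hm _]] := tropic_tangent nd pS tv.
rewrite /light_like; split=> [m0|d0].
  move/eqP: Hm; rewrite m0 mulr0 eq_sym expf_eq0 mulf_eq0 /=.
  by move: k0; rewrite exprn_even_gt0//= => /negPf -> /eqP.
move/eqP: Hm; rewrite d0 mulr0 expr0n mulf_eq0.
by rewrite (gt_eqF r0) => /eqP.
Qed.

Lemma space_like_tropic (R : realType) (a b c lam : R) (p v : 'rV[R]_3) :
  nondegenerate_quadric a b c lam -> tropic_set a b c lam p ->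
  tangent_direction (tropic_set a b c lam) p v ->
  tropic_discr a b c lam p <> 0 -> space_like v.
Proof.
move=> nd pS tv /eqP d0; have [k [k0 r0 Hm _]] := tropic_tangent nd pS tv.
rewrite /space_like -(pmulr_rgt0 _ r0) Hm exprn_even_gt0//= mulf_neq0//.
by move: k0; rewrite exprn_even_gt0.
Qed.

(** Since v is orthogonal to p, the form equals 1 + t^2 q(v) at p + tv, so the line lies in the
    quadric iff q(v) = 0 (t = 1 suffices as a test). Then r^2 q(v) = k^2 D concludes. *)
Lemma line_quadric_tropicP (R : realType) (a b c lam : R) (p v : 'rV[R]_3) :
  nondegenerate_quadric a b c lam -> tropic_set a b c lam p ->
  tangent_direction (tropic_set a b c lam) p v ->
  line p v `<=` quadric a b c lam <-> tropic_discr a b c lam p = 0.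
Proof.
move=> nd pS tv; have [k [k0 r0 _ Hq]] := tropic_tangent nd pS tv.
have pv : diag_form (a - lam)^-1 (b - lam)^-1 (c + lam)^-1 p v = 0.
  by apply: (diag_form_tangent (e := 1)) tv.2 => q []; rewrite quadricE.
have pp : diag_form (a - lam)^-1 (b - lam)^-1 (c + lam)^-1 p p = 1.
  by case: pS; rewrite quadricE.
have lE t : diag_form (a - lam)^-1 (b - lam)^-1 (c + lam)^-1
    (p + t *: v) (p + t *: v)
    = 1 + t ^+ 2 * diag_form (a - lam)^-1 (b - lam)^-1 (c + lam)^-1 v v.
  rewrite -pp -[RHS]addr0 -[X in _ = _ + X](mulr0 (2 * t)) -pv /diag_form !mxE.
  by ring.
rewrite quadricE; split=> [lQ|d0 _ [t _ <-]] /=.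
  have /= : [set q | diag_form (a - lam)^-1 (b - lam)^-1 (c + lam)^-1 q q = 1]
      (p + 1 *: v) by apply: lQ; exists 1.
  rewrite lE expr1n mul1r addrC => /eqP; rewrite -subr_eq0 addrK => /eqP q0.
  move/eqP: Hq; rewrite q0 mulr0 eq_sym mulf_eq0 (gt_eqF k0).
  by move=> /eqP.
rewrite lE; move/eqP: Hq; rewrite d0 mulr0 mulf_eq0 (gt_eqF r0) => /eqP ->.
by rewrite mulr0 addr0.
Qed.

(** * The three assertions on the tangent lines of tropic curves *)

Theorem proposition4p7 (R : realType) (a b c : R)
    (hab : b < a) (hb : 0 < b) (hc : 0 < c) :
  [/\ forall (lam : R) (T : set 'rV[R]_3), nondegenerate_quadric a b c lam ->
        ~ oriented_along_y a b lam -> tropic_curve a b c lam T ->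
        forall p v : 'rV[R]_3, T p -> tangent_direction T p v -> space_like v,
      forall (lam : R) (T : set 'rV[R]_3), oriented_along_y a b lam ->
        tropic_curve a b c lam T ->
        [set p | T p /\ light_like_tangent_at T p] #= `I_4 /\
        (forall p v : 'rV[R]_3, T p -> ~ light_like_tangent_at T p ->
           tangent_direction T p v -> space_like v)
    & forall (lam : R) (T : set 'rV[R]_3), nondegenerate_quadric a b c lam ->
        tropic_curve a b c lam T ->
        forall p v : 'rV[R]_3, T p -> tangent_direction T p v ->
        (line p v `<=` quadric a b c lam <-> light_like v)].
Proof.
have ac : 0 < a + c by lra.
have bc : 0 < b + c by lra.
(* A tropic curve is a part of the tropic set, so its tangent directions are tangent directions of
   the whole set. *)
have sub lam T p v : tropic_curve a b c lam T -> T p ->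
    tangent_direction T p v ->
    tropic_set a b c lam p /\ tangent_direction (tropic_set a b c lam) p v.
  move=> [q _ ->] Tp [v0 [g [g0 Tg dg]]].
  split; first exact: connected_component_sub Tp.
  split=> //; exists g; split=> //.
  by apply: filterS Tg => t; exact: connected_component_sub.
split=> [lam T nd nor Tc p v Tp Tv|lam T /andP[lb la] Tc|lam T nd Tc p v Tp Tv].
- have [pS vS] := sub _ _ _ _ Tc Tp Tv.
  apply: (space_like_tropic nd pS vS) => d0.
  have [la lb _] := nd.
  have [_ ellipse] := (tropic_setE p nd).1 pS.
  move: d0 ellipse; rewrite /tropic_discr.
  set u := _ / (a - lam); set w := _ / (b - lam).
  have := sqr_ge0 u; have := sqr_ge0 w.
  move=> w2 u2 d0 ellipse.
  (* D = 0 combined with the ellipse expresses lam - b and a - lam as nonnegative quantities. Thus b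
     <= lam <= a, strictly by nondegeneracy, against the assumed orientation. *)
  have P0 : 0 <= (a - b) * ((b + c) * w ^+ 2).
    by apply: mulr_ge0; [lra|apply: mulr_ge0 => //; exact: ltW].
  have Q0 : 0 <= (a - b) * ((a + c) * u ^+ 2).
    by apply: mulr_ge0; [lra|apply: mulr_ge0 => //; exact: ltW].
  have eP : lam - b = (a - b) * ((b + c) * w ^+ 2).
    by rewrite -[LHS]mulr1 -ellipse -[LHS]addr0 -d0; ring.
  have eQ : a - lam = (a - b) * ((a + c) * u ^+ 2).
    by rewrite -[LHS]mulr1 -ellipse -[LHS]subr0 -d0; ring.
  apply: nor; rewrite /oriented_along_y !lt_neqAle la (eq_sym b) lb /=.
  by rewrite -subr_ge0 eP P0 -subr_ge0 eQ Q0.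
- have nd : nondegenerate_quadric a b c lam.
    by split; [rewrite lt_eqF|rewrite gt_eqF|rewrite gt_eqF//; lra].
  have [e ee TE] := tropic_curve_half ac bc nd Tc.
  (* Light-likeness depends only on D at p, not on the tangent vector chosen, so one existing
     tangent decides for all. *)
  have lightP p : T p ->
      light_like_tangent_at T p <-> tropic_discr a b c lam p = 0.
    move=> Tp; split=> [[[v Tv] /(_ v Tv) vl]|d0].
      have [pS vS] := sub _ _ _ _ Tc Tp Tv.
      exact/(light_like_tropicP nd pS vS).
    split=> [|v Tv].
      by rewrite TE in Tp *; exact: tropic_half_tangent_direction.
    have [pS vS] := sub _ _ _ _ Tc Tp Tv.
    exact/(light_like_tropicP nd pS vS).
  split=> [|p v Tp nl Tv].
    rewrite (_ : [set p | _] =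
      [set p | tropic_half a b c lam e p /\ tropic_discr a b c lam p = 0]).
      exact: card_tropic_discr0.
    rewrite -TE; apply/seteqP; split=> p /= [Tp] h; split=> //.
      exact/lightP.
    exact/lightP.
  have [pS vS] := sub _ _ _ _ Tc Tp Tv.
  apply: (space_like_tropic nd pS vS) => d0; apply: nl.
  exact/lightP.
- have [pS vS] := sub _ _ _ _ Tc Tp Tv.
  (* Both sides are equivalent to the vanishing of D at p. *)
  by rewrite (light_like_tropicP nd pS vS) (line_quadric_tropicP nd pS vS).
Qed.
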